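(* Let $\lambda\in\mathbb{R}\setminus\{0\}$, let $n\ge2$ be an integer and $0<\varepsilon\le1$. For $u_0\in H^1(\Omega)\cap L^\alpha(\Omega)$ with $\alpha\in(0,2)$, the regularized energy $E_n^\varepsilon(u_0)$ converges to the energy $E(u_0)$ with $$|E_n^\varepsilon(u_0)-E(u_0)|\le|\lambda|\,\|u_0\|_{L^\alpha}^\alpha\,\frac{\varepsilon^{2-\alpha}}{1-\alpha/2}.$$ In addition, for bounded $\Omega$, $$|E_n^\varepsilon(u_0)-E(u_0)|\le|\lambda|\,|\Omega|\,\varepsilon^2.$$
   Context: The domain $\Omega$ is either $\mathbb{R}^d$ or a bounded domain in $\mathbb{R}^d$ ($d=1,2,3$) with Lipschitz continuous boundary, and $|\Omega|$ is its Lebesgue measure. Functions are complex valued. $\|v\|_{L^\alpha}^\alpha=\int_\Omega|v|^\alpha\,dx$ (also for $\alpha<1$). The energies are $$E(v)=\int_\Omega\left[|\nabla v|^2+\lambda F(|v|^2)\right]dx,\qquad E_n^\varepsilon(v)=\int_\Omega\left[|\nabla v|^2+\lambda F_n^\varepsilon(|v|^2)\right]dx,$$ where $F(\rho)=\rho\ln\rho-\rho$ for $\rho\ge 0$ (with $F(0)=0$), and $$F_n^\varepsilon(\rho)=\begin{cases}\rho\ln\rho-\rho, & \rho\ge\varepsilon^2,\\[2pt] \rho\left[\ln(\varepsilon^2)-1-\sum_{k=1}^{n}\frac1k\left(1-\frac{\rho}{\varepsilon^2}\right)^k\right], & 0\le\rho<\varepsilon^2.\end{cases}$$ *)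

(* Defs.v *)
From HB Require Import structures.
From mathcomp Require Import all_boot all_order all_algebra.
From mathcomp Require Import all_classical all_reals all_analysis.
From mathcomp Require Import complex.

Set Implicit Arguments.
Unset Strict Implicit.
Unset Printing Implicit Defensive.

Import Order.TTheory GRing.Theory Num.Theory.
Import numFieldNormedType.Exports.
Import ComplexField.Normc.

Local Open Scope classical_set_scope.
Local Open Scope ring_scope.

Section lebesgue_rV.
Variable R : realType.

Definition borel_rV (d : nat) := g_sigma_algebraType (@open 'rV[R]_d).

(* The point (y, x_0, ..., x_(d-1)) of R^(d+1), for p = (x, y). *)
Definition rV_cons (d : nat) (p : borel_rV d * measurableTypeR R) :
    borel_rV d.+1 :=
  \row_(j < d.+1) if unlift ord0 j is Some k then (p.1 : 'rV[R]_d) 0 k else p.2.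

(* Lebesgue measure on R^d, restricted to Borel sets: Dirac mass for d = 0, then
   products with the one-dimensional Lebesgue measure. *)
Fixpoint lebesgue_rV (d : nat) : set (borel_rV d) -> \bar R :=
  match d with
  | 0 => \d_((0 : 'rV[R]_0) : borel_rV 0)
  | d'.+1 => pushforward (@lebesgue_rV d' \x lebesgue_measure)%E (@rV_cons d')
  end.

Lemma open_measurable_rV (d : nat) (A : set 'rV[R]_d) :
  open A -> measurable (A : set (borel_rV d)).
Proof. by move=> oA; exact: sub_sigma_algebra. Qed.

Lemma preimage_rV_cons_ball (d : nat) (c : 'rV[R]_d.+1) (e : R) : 0 < e ->
  @rV_cons d @^-1` ball c e =
  ball (\row_j c 0 (lift ord0 j)) e `*` ball (c 0 0) e.
Proof.
move=> e0; apply/seteqP; split=> [[x y]|[x y] [[_ /= hx] hy]] /=.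
- move=> [_ H]; split.
    split=> // i j; have := H i (lift ord0 j).
    by rewrite (ord1 i) !mxE liftK.
  by have := H 0 0; rewrite !mxE unlift_none.
- split=> // i j; rewrite (ord1 i) mxE; case: unliftP => [k|] ->//.
  by have := hx 0 k; rewrite mxE.
Qed.

Lemma open_rV_bigcup_ball (d : nat) (A : set 'rV[R]_d) : open A ->
  A = \bigcup_(p in [set p : 'rV[rat]_d * nat |
                     ball (map_mx ratr p.1 : 'rV[R]_d) p.2.+1%:R^-1 `<=` A])
        ball (map_mx ratr p.1 : 'rV[R]_d) p.2.+1%:R^-1.
Proof.
move=> oA; apply/seteqP; split=> [x Ax|x [p pA]]; last exact: pA.
have [e /= e0 eA] : exists2 e : R, 0 < e & ball x e `<=` A.
  by apply/nbhs_ballP; move: oA; rewrite openE => /(_ _ Ax).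
have [k ke] : exists k : nat, k.+1%:R^-1 < e / 2.
  exists (Num.trunc (e / 2)^-1); rewrite invf_plt ?posrE ?divr_gt0//.
  by rewrite -truncn_lt_nat// invr_ge0 ltW// divr_gt0.
have k0 : 0 < k.+1%:R^-1 :> R by rewrite invr_gt0.
have /choice[q qx] (i : 'I_d) : exists q : rat, `|x 0 i - ratr q| < k.+1%:R^-1.
  have /rat_in_itvoo[q] : x 0 i - k.+1%:R^-1 < x 0 i + k.+1%:R^-1.
    by rewrite ltrD2l gt0_cp.
  by rewrite in_itv/= => xq; exists q; rewrite distrC ltr_distl.
have qxb : ball (map_mx ratr (\row_i q i) : 'rV[R]_d) k.+1%:R^-1 x.
  split=> // i j; rewrite (ord1 i) !mxE; apply: ball_sym; exact: qx.
exists (\row_i q i, k) => //= y qy; apply: eA.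
apply: (@le_ball _ _ _ (k.+1%:R^-1 + k.+1%:R^-1)).
  by rewrite [leRHS]splitr; apply: lerD; exact: ltW.
exact: ball_triangle (ball_sym qxb) qy.
Qed.

Lemma measurable_rV_cons (d : nat) : measurable_fun setT (@rV_cons d).
Proof.
have := @measurability _ _ _ (borel_rV d.+1) setT (@rV_cons d)
  (@open 'rV[R]_d.+1) erefl; apply => // _ [A oA <-].
rewrite setTI (open_rV_bigcup_ball oA) preimage_bigcup.
rewrite bigcup_mkcond.
apply: countable_bigcupT_measurable => [|p]; first exact: countableP.
case: ifPn => // _; rewrite preimage_rV_cons_ball ?invr_gt0//; apply: measurableX.
  apply: open_measurable_rV; apply: (@ball_open R 'rV[R]_d).
by apply: measurable_realfun.open_measurable; exact: ball_open.
Qed.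

Lemma lebesgue_rV_is_measure (d : nat) :
  exists m : {measure set (borel_rV d) -> \bar R},
    lebesgue_rV (d := d) = m.
Proof.
elim: d => [|d [m mE]]; first by exists \d_(0 : borel_rV 0).
have mf := @measurable_rV_cons d.
pose pm := (m \x (@lebesgue_measure R))%E.
exists (measure_function_pushforward__canonical__measure_function_Measure
  pm mf); by rewrite /= mE.
Qed.

Section measure.
Variable d : nat.
Let mu : set (borel_rV d) -> \bar R := lebesgue_rV (d := d).

Let mu0 : mu set0 = 0%E.
Proof. rewrite /mu; have [m ->] := lebesgue_rV_is_measure d; exact: measure0. Qed.

Let mu_ge0 A : (0 <= mu A)%E.
Proof. by rewrite /mu; have [m ->] := lebesgue_rV_is_measure d. Qed.

Let mu_sigma_additive : semi_sigma_additive mu.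
Proof.
rewrite /mu; have [m ->] := lebesgue_rV_is_measure d.
exact: measure_semi_sigma_additive.
Qed.

HB.instance Definition _ := isMeasure.Build _ _ _ (@lebesgue_rV d)
  mu0 mu_ge0 mu_sigma_additive.

End measure.

Lemma lebesgue_rV_box (d : nat) (a b : 'rV[R]_d) :
  (forall i, a 0 i <= b 0 i) ->
  lebesgue_rV [set x : borel_rV d | forall i,
                 a 0 i < (x : 'rV[R]_d) 0 i < b 0 i] =
  (\prod_i (b 0 i - a 0 i))%:E.
Proof.
elim: d a b => [|d IH] a b ab.
  rewrite big_ord0 /= diracE mem_set//= => -[]//.
pose a' := \row_i a 0 (lift ord0 i); pose b' := \row_i b 0 (lift ord0 i).
have mA : measurable [set x : borel_rV d | forall i,
    a' 0 i < (x : 'rV[R]_d) 0 i < b' 0 i].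
  rewrite (_ : mkset _ = \bigcap_(i in [set: 'I_d])
      ((fun x : 'rV[R]_d => x 0 i) @^-1` `]a' 0 i, b' 0 i[%classic)).
    apply: fin_bigcap_measurable => // i _; apply: open_measurable_rV.
    apply: open_comp => [x _|]; first exact: coord_continuous.
    exact: interval_open.
  apply/seteqP; split=> [x h i _|x h i] /=; first by rewrite in_itv/= h.
  by have := h i I; rewrite /= in_itv.
rewrite /= /pushforward (_ : _ @^-1` _ =
    [set x : borel_rV d | forall i, a' 0 i < (x : 'rV[R]_d) 0 i < b' 0 i] `*`
    (`]a 0 0, b 0 0[%classic : set (measurableTypeR R))).
  have [m mE] := lebesgue_rV_is_measure d.
  rewrite mE product_measure1E; [|exact: mA|exact: measurable_itv].
  rewrite -mE IH => [|i]; last by rewrite !mxE.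
  rewrite [X in (_ * X)%E](_ : _ = (b 0 0 - a 0 0)%:E).
    by rewrite big_ord_recl mulrC; under eq_bigr do rewrite !mxE.
  transitivity (@lebesgue_measure R `]a 0 0, b 0 0[%classic) => //.
  rewrite lebesgue_measure_itv/= lte_fin.
  have := ab 0; rewrite le_eqVlt => /predU1P[<-|->//].
  by rewrite ltxx subrr.
apply/seteqP; split=> [[x y] /= h|[x y] /= [h1 h2] i].
  split=> [i|]; first by have := h (lift ord0 i); rewrite !mxE liftK.
  by have := h 0; rewrite mxE unlift_none in_itv.
rewrite mxE; case: unliftP => [k|] ->; last by move: h2; rewrite in_itv.
by have := h1 k; rewrite !mxE.
Qed.

End lebesgue_rV.

Section domains.
Variables (R : realType) (d : nat).
Implicit Type Omega : set 'rV[R]_d.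

Definition is_domain Omega := [/\ open Omega, connected Omega & Omega !=set0].

(* Near every boundary point Omega is, after an orthogonal change of
   coordinates, the strict epigraph of a Lipschitz function of the remaining
   d - 1 coordinates. *)
Definition lipschitz_boundary Omega :=
  forall x : 'rV[R]_d, (closure Omega `\` Omega^°) x ->
  exists (Q : 'M[R]_d) (i : 'I_d) (phi : 'rV[R]_d.-1 -> R),
    [/\ Q *m Q^T = 1%:M, lipschitz phi &
        \forall y \near x,
          Omega y <-> phi (col' i (y *m Q)) < (y *m Q) 0 i].

Definition admissible_domain Omega :=
  Omega = setT \/
  [/\ is_domain Omega, bounded_set Omega & lipschitz_boundary Omega].

End domains.

Section sobolev.
Variables (R : realType) (d : nat).
Implicit Types (Omega : set 'rV[R]_d) (v g : 'rV[R]_d -> R[i]).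
Implicit Types (phi : 'rV[R]_d -> R) (j : 'I_d).

Definition partial j phi : 'rV[R]_d -> R := 'D_(delta_mx 0 j) phi.

Definition smooth phi := forall s : seq 'I_d,
  continuous (foldr partial phi s) /\
  forall j x, derivable (foldr partial phi s) x (delta_mx 0 j).

Definition test_function Omega phi :=
  let supp := closure [set x | phi x != 0] in
  [/\ smooth phi, compact supp & supp `<=` Omega].

Definition integralC Omega v : R[i] :=
  Complex (\int[@lebesgue_rV R d]_(x in Omega) complex.Re (v x))
          (\int[@lebesgue_rV R d]_(x in Omega) complex.Im (v x)).

Definition measurable_funC Omega v :=
  measurable_fun (Omega : set (borel_rV R d)) (fun x => complex.Re (v x)) /\
  measurable_fun (Omega : set (borel_rV R d)) (fun x => complex.Im (v x)).

Definition mem_Lp (p : R) Omega v :=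
  measurable_funC Omega v /\
  (\int[@lebesgue_rV R d]_(x in Omega) ((normc (v x)) `^ p)%:E < +oo)%E.

(* ||v||_{L^p}^p *)
Definition Lp_norm_pow (p : R) Omega v : R :=
  \int[@lebesgue_rV R d]_(x in Omega) (normc (v x)) `^ p.

(* g is a square integrable weak j-th partial derivative of v on Omega. *)
Definition is_weak_partial Omega j v g :=
  mem_Lp 2 Omega g /\
  forall phi, test_function Omega phi ->
    integralC Omega (fun x => v x * (partial j phi x)%:C%C) =
    - integralC Omega (fun x => g x * (phi x)%:C%C).

Definition mem_H1 Omega v :=
  mem_Lp 2 Omega v /\ forall j, exists g, is_weak_partial Omega j v g.

(* The weak derivative is unique up to a null set, so that the choice made here
   does not affect integrals. *)
Definition weak_partial Omega j v : 'rV[R]_d -> R[i] :=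
  xget (fun=> 0) [set g | is_weak_partial Omega j v g].

Definition sqr_norm_grad Omega v (x : 'rV[R]_d) : R :=
  \sum_(j < d) normc (weak_partial Omega j v x) ^+ 2.

End sobolev.

Section energy.
Variable R : realType.

(* ln 0 = 0 in the library, so that F 0 = 0. *)
Definition F (rho : R) : R := rho * ln rho - rho.

Definition F_reg (n : nat) (eps rho : R) : R :=
  if eps ^+ 2 <= rho then rho * ln rho - rho
  else rho * (ln (eps ^+ 2) - 1
              - \sum_(1 <= k < n.+1) k%:R^-1 * (1 - rho / eps ^+ 2) ^+ k).

Definition energy_with (d : nat) (G : R -> R) (lambda : R)
    (Omega : set 'rV[R]_d) (v : 'rV[R]_d -> R[i]) : R :=
  \int[@lebesgue_rV R d]_(x in Omega)
    (sqr_norm_grad Omega v x + lambda * G (normc (v x) ^+ 2)).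

Definition energy (d : nat) := @energy_with d F.

Definition energy_reg (d n : nat) (eps : R) := @energy_with d (F_reg n eps).

End energy.

(* Main.v *)
(** For 0 < rho < eps^2, with s = rho / eps^2, the difference F_n^eps - F equals
    rho times the remainder - ln s - sum_(k <= n) (1 - s)^k / k of the Taylor
    series of - ln at 1, and it vanishes for other rho.  The remainder lies
    between 0 and ln (1 / s) <= s^(- b) / b for every b > 0; b = 1 - alpha / 2
    gives the L^alpha bound and b = 1 the bound eps^2, after integration.  *)
Require Import Defs.
From mathcomp Require Import all_boot all_order all_algebra.
From mathcomp Require Import all_classical all_reals all_analysis.
From mathcomp Require Import complex.
From mathcomp Require Import measurable_realfun ring lra.

Set Implicit Arguments.
Unset Strict Implicit.
Unset Printing Implicit Defensive.

Import Order.TTheory GRing.Theory Num.Theory.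
Import numFieldNormedType.Exports.

Local Open Scope classical_set_scope.
Local Open Scope ring_scope.

(** * Pointwise bounds on the regularization error of the logarithmic nonlinearity *)

Section scalar_bounds.
Variable R : realType.
Implicit Types (alpha eps rho x : R) (n : nat).

(** The difference [f] of the two sides vanishes at 1, and its derivative [- (1 - y) ^+ n / y] is
    nonpositive on []0, 1]], so [f x] is at least [f 1]. *)
Lemma taylor_ln_le n x : 0 < x <= 1 ->
  \sum_(1 <= k < n.+1) k%:R^-1 * (1 - x) ^+ k <= - ln x.
Proof.
move=> /andP[x0 x1].
pose f : R -> R := (fun y : R => - ln y) -
  \sum_(k < n) (fun y : R => k.+1%:R^-1 * (1 - y) ^+ k.+1).
have fE (y : R) : f y = - ln y - \sum_(1 <= k < n.+1) k%:R^-1 * (1 - y) ^+ k.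
  by rewrite /f big_add1 big_mkord; congr (_ - _); rewrite fct_sumE.
pose df (y : R) := - y^-1 - \sum_(k < n) - (1 - y) ^+ k.
have fD (y : R) : 0 < y -> is_derive y 1 f (df y).
  move=> y0; apply: is_deriveB.
    by apply: is_deriveN; exact: is_derive1_ln.
  apply: is_derive_sum => k.
  (* The derivative is put in chain-rule shape, with [0 - 1] the derivative of [cst 1 - id]. *)
  have -> : - (1 - y) ^+ k = k.+1%:R^-1 *: ((k.+1%:R * (1 - y) ^+ k) *: (0 - 1)).
    rewrite /GRing.scale/= sub0r mulrA mulrA mulVf ?pnatr_eq0// mul1r.
    by rewrite mulrN1.
  apply: is_deriveZ.
  have -> : (fun z : R => (1 - z) ^+ k.+1) = (cst 1 - id) ^+ k.+1.
    by rewrite exprfctE.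
  have D : is_derive y (1 : R)
      (cst 1 - id : R -> R) (0 - 1) by apply: is_deriveB.
  exact: (is_deriveX k.+1 D).
have dfE (y : R) : 0 < y -> df y = - ((1 - y) ^+ n / y).
  move=> y0; have y0' : y != 0 by rewrite gt_eqF.
  (* Geometric sum: [y] times the sum of the [(1 - y) ^+ k] for [k < n] is [1 - (1 - y) ^+ n]. *)
  have := subrXX 1 (1 - y) n; rewrite expr1n subKr.
  under eq_bigr do rewrite expr1n mul1r.
  move=> h; rewrite /df sumrN opprK.
  apply: (mulfI y0'); rewrite mulrDr -h; field.
  exact: y0'.
have : f 1 <= f x.
  apply: (@ler0_derive1_le_cc _ f x 1) => [y|y||||//]; last 2 first.
  - by rewrite in_itv/= x1 lexx.
  - by rewrite in_itv/= lexx.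
  - by rewrite in_itv/= => /andP[xy _]; have := fD _ (lt_trans x0 xy); case.
  - rewrite in_itv/= => /andP[xy y1]; have y0 := lt_trans x0 xy.
    have D := fD _ y0; rewrite derive1E derive_val dfE// oppr_le0.
    by rewrite divr_ge0 ?exprn_ge0 ?subr_ge0// ltW.
  - apply: derivable_within_continuous => y; rewrite in_itv/= => /andP[xy _].
    by have := fD _ (lt_le_trans x0 xy); case.
rewrite !fE ln1 oppr0 subrr sub0r big_nat big1 ?oppr0 ?subr_ge0//.
by move=> k /andP[k0 _]; rewrite expr0n eqn0Ngt k0 mulr0.
Qed.

(** The difference is [rho * (ln (eps ^+ 2) - ln rho - S)] with [S] the Taylor sum at
    [rho / eps ^+ 2]. The lower bound is [taylor_ln_le]; the upper one only drops [S], whose terms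
    are nonnegative. *)
Lemma F_reg_sub_bounds n eps rho : 0 < eps -> 0 < rho < eps ^+ 2 ->
  0 <= F_reg n eps rho - F rho <= rho * ln (eps ^+ 2 / rho).
Proof.
move=> e0 /andP[r0 re]; have E0 : 0 < eps ^+ 2 by rewrite exprn_gt0.
rewrite /F_reg (leNgt (eps ^+ 2)) re/= /F.
have s0 : 0 < rho / eps ^+ 2 by rewrite divr_gt0.
have s1 : rho / eps ^+ 2 <= 1 by rewrite ler_pdivrMr// mul1r ltW.
have := @taylor_ln_le n (rho / eps ^+ 2); rewrite s0 s1 => /(_ isT).
have : 0 <= \sum_(1 <= k < n.+1) k%:R^-1 * (1 - rho / eps ^+ 2) ^+ k.
  apply: sumr_ge0 => k _.
  by rewrite mulr_ge0 ?invr_ge0// exprn_ge0// subr_ge0.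
set S := \sum_(_ <= _ < _) _ => S0.
rewrite !ln_div ?posrE// => hS.
rewrite [X in _ <= X <= _](_ : _ = rho * (ln (eps ^+ 2) - ln rho - S)); last by ring.
apply/andP; split; first by apply: mulr_ge0; [exact: ltW|lra].
by apply: ler_wpM2l; [exact: ltW|lra].
Qed.

(** Confines later estimates to [0 < rho < eps ^+ 2]: both functions vanish at 0 and they coincide
    from [eps ^+ 2] on. *)
Lemma norm_F_reg_sub_le n eps rho b : 0 < eps -> 0 <= rho -> 0 <= b ->
  (0 < rho < eps ^+ 2 -> rho * ln (eps ^+ 2 / rho) <= b) ->
  `|F_reg n eps rho - F rho| <= b.
Proof.
move=> e0; rewrite le_eqVlt => /predU1P[<- b0 _|r0 b0 h].
  by rewrite /F_reg /F (leNgt (eps ^+ 2)) exprn_gt0//= !mul0r !subr0 normr0.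
have [re|re] := leP (eps ^+ 2) rho; first by rewrite /F_reg re subrr normr0.
have rr : 0 < rho < eps ^+ 2 by rewrite r0.
have /andP[h0 h1] := F_reg_sub_bounds n e0 rr.
by rewrite ger0_norm// (le_trans h1)// h.
Qed.

Lemma norm_F_reg_sub_le_sqr n eps rho : 0 < eps -> 0 <= rho ->
  `|F_reg n eps rho - F rho| <= eps ^+ 2.
Proof.
move=> e0 r0; apply: norm_F_reg_sub_le => // [|/andP[{}r0 re]].
  exact: exprn_ge0 (ltW e0).
have E0 : 0 < eps ^+ 2 by rewrite exprn_gt0.
(* With [y = eps ^+ 2 / rho], the claim becomes [ln y <= y]. *)
by rewrite -ler_pdivlMl// [leRHS]mulrC ltW// ln_sublinear// divr_gt0.
Qed.

Lemma norm_F_reg_sub_le_powR n alpha eps rho : alpha < 2 ->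
  0 < eps -> 0 <= rho ->
  `|F_reg n eps rho - F rho|
    <= rho `^ (alpha / 2) * (eps `^ (2 - alpha) / (1 - alpha / 2)).
Proof.
move=> a2 e0 r0; set b := 1 - alpha / 2.
have b0 : 0 < b by rewrite /b; lra.
apply: norm_F_reg_sub_le => // [|/andP[{}r0 re]].
  by rewrite mulr_ge0 ?divr_ge0 ?powR_ge0// ltW.
have E0 : 0 < eps ^+ 2 by rewrite exprn_gt0.
set y := eps ^+ 2 / rho; have y0 : 0 < y by rewrite divr_gt0.
have lny : ln y <= y `^ b / b.
  rewrite ler_pdivlMr// mulrC -ln_powR ltW// ln_sublinear//.
  exact: powR_gt0.
apply: (le_trans (ler_wpM2l (ltW r0) lny)).
rewrite le_eqVlt; apply/orP; left; apply/eqP; rewrite !mulrA; congr (_ / b).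
(* Here [2 - alpha = 2 * b] and [eps ^+ 2 = rho * y]; the remaining powers of [rho] match because
   [alpha / 2 + b = 1]. *)
have -> : eps `^ (2 - alpha) = rho `^ b * y `^ b.
  rewrite -powRM; [|exact: ltW..].
  rewrite /y mulrC divfK ?gt_eqF// -powR_mulrn ?ltW// -powRrM.
  by congr (_ `^ _); rewrite /b; field.
rewrite mulrA -powRD; last by rewrite (gt_eqF r0) implybT.
by rewrite (_ : alpha / 2 + b = 1) ?powRr1 ?ltW// /b; ring.
Qed.

Lemma measurable_F : measurable_fun setT (@F R).
Proof.
by apply: measurable_funB => //; apply: measurable_funM.
Qed.

Lemma measurable_F_reg n eps : measurable_fun setT (F_reg n eps).
Proof.
apply: measurable_fun_ifT.
- by apply: measurable_fun_ler.
- exact: measurable_F.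
- apply: measurable_funM => //; apply: measurable_funB => //.
  apply: measurable_sum => k; apply: measurable_funM => //.
  apply: measurable_funX; apply: measurable_funB => //.
  exact: measurable_funM.
Qed.

End scalar_bounds.

(** * Comparison of real-valued integrals under a dominated difference *)

Section Rintegral_comparison.
Context d (T : measurableType d) (R : realType).
Variable mu : {measure set T -> \bar R}.
Implicit Types (D : set T) (f g h : T -> R).

(** For a measurable function, failure of integrability makes the extended integral infinite, and
    [fine] sends both infinities to 0. *)
Lemma Rintegral_nonintegrable D f : measurable D -> measurable_fun D f ->
  ~ mu.-integrable D (EFin \o f) -> \int[mu]_(x in D) f x = 0.
Proof.
move=> mD mf nf; rewrite /Rintegral.
have : ~~ ((\int[mu]_(x in D) (f x)%:E)%E \is a fin_num).
  rewrite -integral_fin_num_abs//; apply/negP => foo; apply: nf.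
  by apply/integrableP; split => //; exact/measurable_EFinP.
by rewrite fin_numEn => /orP[|] /eqP ->.
Qed.

(* Integrability of f and g is not assumed: if f - g is integrable then f and g
   are both integrable or both not, and in the latter case both real-valued
   integrals take the junk value 0. *)
Lemma le_norm_RintegralB D f g h : measurable D ->
  measurable_fun D f -> measurable_fun D g -> mu.-integrable D (EFin \o h) ->
  (forall x, D x -> `|f x - g x| <= h x) ->
  `|\int[mu]_(x in D) f x - \int[mu]_(x in D) g x| <= \int[mu]_(x in D) h x.
Proof.
move=> mD mf mg ih fgh.
have h0 x : D x -> 0 <= h x by move=> /fgh; exact: le_trans.
have ifg : mu.-integrable D (EFin \o (fun x => f x - g x)).
  apply: le_integrable ih => //.
    by apply/measurable_EFinP; exact: measurable_funB.
  by move=> x Dx /=; rewrite lee_fin (le_trans (fgh _ Dx))// ler_norm.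
have [ig|ng] := pselect (mu.-integrable D (EFin \o g)).
  have if_ : mu.-integrable D (EFin \o f).
    rewrite (_ : _ \o _ = ((EFin \o (fun x => f x - g x)%R) \+ (EFin \o g))%E).
      exact: integrableD.
    by apply/funext => x /=; rewrite -EFinD subrK.
  rewrite -RintegralB//; apply: le_trans (le_normr_Rintegral mD ifg) _.
  apply: le_Rintegral => //.
  exact: integrable_abse ifg.
have nf : ~ mu.-integrable D (EFin \o f).
  move=> if_; apply: ng.
  rewrite (_ : _ \o _ = ((EFin \o f) \- (EFin \o (fun x => f x - g x)%R))%E).
    exact: integrableB.
  by apply/funext => x /=; rewrite -EFinB subKr.
rewrite (Rintegral_nonintegrable mD mf nf) (Rintegral_nonintegrable mD mg ng).
rewrite subrr normr0.
exact: Rintegral_ge0.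
Qed.

End Rintegral_comparison.

(** * Measurability of the energy densities and comparison of the energies *)

Section measurability.
Variables (R : realType) (d : nat) (Omega : set 'rV[R]_d).
Implicit Types v : 'rV[R]_d -> R[i].
Local Notation OmegaB := (Omega : set (borel_rV R d)).

Lemma admissible_domain_measurable : admissible_domain Omega ->
  measurable OmegaB.
Proof.
move=> [->|[[oO _ _] _ _]]; first exact: measurableT.
exact: open_measurable_rV.
Qed.

Lemma measurable_sqr_normc v : measurable_funC Omega v ->
  measurable_fun OmegaB (fun x => Normc.normc (v x) ^+ 2).
Proof.
move=> [mre mim].
rewrite (_ : (fun _ => _) = fun x => complex.Re (v x) ^+ 2 + complex.Im (v x) ^+ 2).
  by apply: measurable_funD; exact: measurable_funX.
apply/funext => x; case: (v x) => a b /=.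
by rewrite sqr_sqrtr// addr_ge0// sqr_ge0.
Qed.

Lemma measurable_sqr_norm_grad v : mem_H1 Omega v ->
  measurable_fun OmegaB (sqr_norm_grad Omega v).
Proof.
move=> [_ H]; apply: measurable_sum => j; apply: measurable_sqr_normc.
(* Membership in [H^1] provides a weak derivative, so the choice made by [xget] is a genuine one and
   not the default 0. *)
by have [g wg] := H j; have [[]] : is_weak_partial Omega j v (weak_partial Omega j v)
  by exact: (xgetPex (fun=> 0) (ex_intro _ g wg)).
Qed.

Lemma measurable_energy_density (G : R -> R) lambda v : mem_H1 Omega v ->
  measurable_fun setT G ->
  measurable_fun OmegaB (fun x =>
    sqr_norm_grad Omega v x + lambda * G (Normc.normc (v x) ^+ 2)).
Proof.
move=> vH1 mG; apply: measurable_funD; first exact: measurable_sqr_norm_grad.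
apply: measurable_funM => //; apply: (measurableT_comp mG).
by apply: measurable_sqr_normc; case: vH1 => -[].
Qed.

(** The gradient terms cancel pointwise in the difference of the densities, which leaves [lambda]
    times the error of the nonlinearity, dominated by [h]. *)
Lemma le_norm_energyB n eps lambda v h : measurable OmegaB -> mem_H1 Omega v ->
  (@lebesgue_rV R d).-integrable OmegaB (EFin \o h) ->
  (forall x, `|F_reg n eps (Normc.normc (v x) ^+ 2)
               - F (Normc.normc (v x) ^+ 2)| <= h x) ->
  `|energy_reg n eps lambda Omega v - energy lambda Omega v|
    <= `|lambda| * \int[@lebesgue_rV R d]_(x in OmegaB) h x.
Proof.
move=> mO vH1 ih Fh; rewrite -RintegralZl//.
apply: le_norm_RintegralB => //.
- by apply: measurable_energy_density => //; exact: measurable_F_reg.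
- by apply: measurable_energy_density => //; exact: measurable_F.
- exact: (integrableZl mO `|lambda| ih).
- move=> x _; rewrite opprD addrACA subrr add0r -mulrBr normrM.
  exact: ler_wpM2l.
Qed.

End measurability.

Theorem proposition3p4 (R : realType) (d : nat) (Omega : set 'rV[R]_d)
    (lambda alpha : R) (n : nat) (u0 : 'rV[R]_d -> R[i]) :
  (1 <= d <= 3)%N ->
  admissible_domain Omega ->
  lambda != 0 ->
  (2 <= n)%N ->
  0 < alpha < 2 ->
  mem_H1 Omega u0 ->
  mem_Lp alpha Omega u0 ->
  [/\ energy_reg n eps lambda Omega u0 @[eps --> 0^'+]
        --> energy lambda Omega u0,
      forall eps : R, 0 < eps <= 1 ->
        `|energy_reg n eps lambda Omega u0 - energy lambda Omega u0|
        <= `|lambda| * Lp_norm_pow alpha Omega u0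
           * (eps `^ (2 - alpha) / (1 - alpha / 2)) &
      bounded_set Omega ->
      forall eps : R, 0 < eps <= 1 ->
        (`|energy_reg n eps lambda Omega u0 - energy lambda Omega u0|%:E
         <= `|lambda|%:E * @lebesgue_rV R d Omega * (eps ^+ 2)%:E)%E].
Proof.
move=> _ admO l0 _ /andP[a0 a2] uH1 uLp.
have mO := admissible_domain_measurable admO.
have normc_ge0 x : 0 <= Normc.normc (u0 x).
  by case: (u0 x) => a b /=; exact: sqrtr_ge0.
have sqr_powR x : (Normc.normc (u0 x) ^+ 2) `^ (alpha / 2)
    = Normc.normc (u0 x) `^ alpha.
  by rewrite -powR_mulrn// -powRrM mulrC divfK.
have iLp : (@lebesgue_rV R d).-integrable (Omega : set (borel_rV R d))
    (EFin \o (fun x => Normc.normc (u0 x) `^ alpha)).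
  case: uLp => mu0 ltoo; apply/integrableP; split.
    apply/measurable_EFinP.
    (* Measurability passes through the squared modulus, a polynomial in the real and imaginary
       parts. *)
    rewrite (_ : (fun _ => _) =
        (@powR R ^~ (alpha / 2)) \o (fun x => Normc.normc (u0 x) ^+ 2)).
      by apply: measurableT_comp => //; exact: measurable_sqr_normc.
    by apply/funext => x /=; rewrite sqr_powR.
  by under eq_integral do rewrite /= ger0_norm ?powR_ge0//.
have bound eps : 0 < eps <= 1 ->
    `|energy_reg n eps lambda Omega u0 - energy lambda Omega u0|
    <= `|lambda| * Lp_norm_pow alpha Omega u0
       * (eps `^ (2 - alpha) / (1 - alpha / 2)).
  move=> /andP[e0 _]; rewrite -mulrA /Lp_norm_pow -RintegralZr//.
  apply: le_norm_energyB => //.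
    by apply: eq_integrable (integrableZr mO _ iLp).
  move=> x; rewrite -sqr_powR; apply: norm_F_reg_sub_le_powR => //.
  exact: exprn_ge0.
split => //.
- pose c := `|lambda| * Lp_norm_pow alpha Omega u0 / (1 - alpha / 2).
  have c0 : c * eps `^ (2 - alpha) @[eps --> 0^'+] --> (0 : R).
    rewrite -[X in _ --> X](mulr0 c); apply: cvgM; first exact: cvg_cst.
    by apply: powR_cvg0; rewrite subr_gt0.
  apply/cvgrPdistC_le => e e0; near=> eps.
  have eps01 : 0 < eps <= 1.
    by apply/andP; split; near: eps; [exact: nbhs_right_gt|exact: nbhs_right_le].
  apply: le_trans (bound _ eps01) _.
  rewrite mulrA mulrAC -/c; apply: le_trans (ler_norm _) _; near: eps.
  exact: cvgr0_norm_le c0 _ e0.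
- move=> _ eps /andP[e0 _].
  (* If the measure is infinite, the right-hand side is [+oo], since [lambda != 0] and [eps > 0].
     Otherwise the constant [eps ^+ 2] is an integrable dominating function. *)
  have [mu_fin|] := boolP (@lebesgue_rV R d Omega < +oo)%E; last first.
    rewrite -leNgt leye_eq => /eqP ->.
    rewrite gt0_muley ?lte_fin ?normr_gt0// gt0_mulye ?leey//.
    by rewrite lte_fin exprn_gt0.
  have ic : (@lebesgue_rV R d).-integrable (Omega : set (borel_rV R d))
      (EFin \o cst (eps ^+ 2)).
    apply/integrableP; split; first exact/measurable_EFinP.
    rewrite [X in (X < _)%E](integral_cst (@lebesgue_rV R d) mO `|eps ^+ 2|%:E).
    by rewrite lte_mul_pinfty.
  have := @le_norm_energyB R d Omega n eps lambda u0 _ mO uH1 ic.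
  rewrite Rintegral_cst// => le_eps.
  rewrite -[X in (_ * X * _)%E]fineK ?ge0_fin_numE// -!EFinM lee_fin.
  rewrite -mulrA [X in _ * X]mulrC; apply: le_eps => x.
  by apply: norm_F_reg_sub_le_sqr; rewrite ?exprn_ge0.
Unshelve. all: by end_near.
Qed.
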